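(* Let $q$ be a prime power with $q\equiv 1\pmod 3$. Let $\Pi\simeq\mathrm{PG}(7,q)$ be the trace-zero hyperplane of $\mathrm{PG}(8,q)$, let $\Gamma$ be the thin hexagon in $\Pi$, and let $\mathcal{O}=\bigcup_{x\in\Gamma}\pi_x$, where $x$ ranges over all points of $\Gamma$ and $\pi_x$ is the plane spanned by the two lines of $\Gamma$ through $x$ (all as defined in the context). Then $\mathcal{O}$ is not contained in a hyperplane of $\Pi$.
   Context: Let $q\equiv 1\pmod 3$ be a prime power and let $\mathrm{PG}(8,q)$ have homogeneous coordinates $X_1,\dots,X_9$ over the finite field $\mathbb{F}_q$. Identify a $3\times 3$ matrix $M=(m_{ij})$ over $\mathbb{F}_q$ with the vector $(m_{11},m_{12},m_{13},m_{21},m_{22},m_{23},m_{31},m_{32},m_{33})\in\mathbb{F}_q^9$. $\mathcal{S}_{2,2}$ is the Segre variety, the set of $(q^2+q+1)^2$ points of $\mathrm{PG}(8,q)$ represented by $(a_1b_1,a_1b_2,a_1b_3,a_2b_1,a_2b_2,a_2b_3,a_3b_1,a_3b_2,a_3b_3)$ with $a_i,b_i\in\mathbb{F}_q$, $(a_1,a_2,a_3)\neq(0,0,0)$ and $(b_1,b_2,b_3)\ne(0,0,0)$, i.e. the points corresponding to rank-one matrices. $\Pi$ is the hyperplane $X_1+X_5+X_9=0$ (trace-zero matrices), a copy of $\mathrm{PG}(7,q)$. $\Gamma$ is the point-line geometry whose points are the $(q+1)(q^2+q+1)$ points of $\Pi\cap\mathcal{S}_{2,2}$ and whose lines are the $2(q^2+q+1)$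 projective lines contained in $\Pi\cap\mathcal{S}_{2,2}$; it is a thin generalized hexagon, isomorphic to the point-line flag geometry of $\mathrm{PG}(2,q)$. Through each point $x$ of $\Gamma$ there pass exactly two lines of $\Gamma$; they span a plane, denoted $\pi_x$. *)

(* Defs.v *)
From mathcomp Require Import all_boot all_order all_algebra.

Set Implicit Arguments.
Unset Strict Implicit.
Unset Printing Implicit Defensive.

Import GRing.Theory.
Local Open Scope ring_scope.

(** A subspace of projective dimension [d] of the projective space of a vector
    space [V] is a [U : {vspace V}] with [\dim U = d.+1]; incidence is [<=]. *)

Section Projective.
Variables (F : fieldType) (V : vectType F).

Definition proj_point (P : {vspace V}) : Prop := \dim P = 1%N.
Definition proj_line (L : {vspace V}) : Prop := \dim L = 2%N.
Definition hyperplane_of (W H : {vspace V}) : Prop :=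
  (H <= W)%VS /\ \dim W = (\dim H).+1.

End Projective.

Section ThinHexagon.
Variable F : finFieldType.

(** PG(8, q) is the projective space of ['M[F]_3], the coordinates
    [X_1, ..., X_9] being the entries of a matrix in row-major order, so that
    [X_1 + X_5 + X_9] is the trace. *)

Definition Pi : {vspace 'M[F]_3} :=
  lker (linfun (mxtrace : 'M[F]_3 -> F^o)).

Definition segre_point (P : {vspace 'M[F]_3}) : Prop :=
  exists a b : 'rV[F]_3,
    [/\ a != 0, b != 0 & P = <[(\matrix_(i, j) (a 0 i * b 0 j))%R]>%VS].

Definition Gamma_point (x : {vspace 'M[F]_3}) : Prop :=
  segre_point x /\ (x <= Pi)%VS.

Definition Gamma_line (L : {vspace 'M[F]_3}) : Prop :=
  proj_line L /\
  forall P : {vspace 'M[F]_3}, proj_point P -> (P <= L)%VS -> Gamma_point P.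

(** [Gamma_plane x W] reads [W = pi_x]. A point of Gamma lies on exactly two
    lines of Gamma, so [W] is determined by [x]. *)
Definition Gamma_plane (x W : {vspace 'M[F]_3}) : Prop :=
  exists L1 L2 : {vspace 'M[F]_3},
    [/\ Gamma_line L1 /\ (x <= L1)%VS, Gamma_line L2 /\ (x <= L2)%VS,
        L1 <> L2 & W = (L1 + L2)%VS].

(** The set O, as a set of points. *)
Definition calO (P : {vspace 'M[F]_3}) : Prop :=
  proj_point P /\
  exists x W : {vspace 'M[F]_3},
    [/\ Gamma_point x, Gamma_plane x W & (P <= W)%VS].

End ThinHexagon.

(* Main.v *)
(** The matrices [a^T b] with [a b^T = 0] already span [Pi]: off the diagonal
    these include the matrix units [E_ij], and [(e_i + e_j)^T (e_i - e_j)]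
    supplies [E_ii - E_jj].  Since every point of [Gamma] lies in its own plane
    [pi_x], a subspace containing [O] contains [Pi]. *)
Require Import Defs.
From mathcomp Require Import all_boot all_order all_algebra.

Set Implicit Arguments.
Unset Strict Implicit.
Unset Printing Implicit Defensive.

Import GRing.Theory.
Local Open Scope ring_scope.

Lemma dim_span2 (F : fieldType) (V : vectType F) (u v : V) :
  v != 0 -> u \notin <[v]>%VS -> \dim (<[u]> + <[v]>) = 2%N.
Proof.
move=> v0 uv; have fuv : free [:: u; v] by rewrite free_cons span_seq1 uv seq1_free.
by move: fuv; rewrite /free span_cons span_seq1 => /eqP.
Qed.

Lemma dim1_vline (F : fieldType) (V : vectType F) (P : {vspace V}) :
  \dim P = 1%N -> exists2 v, v != 0 & P = <[v]>%VS.
Proof.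
move=> dP; have P0 : P != 0%VS by rewrite -dimv_eq0 dP.
exists (vpick P); first by rewrite vpick0.
apply/esym/eqP; rewrite eqEdim dP dim_vline vpick0 P0 andbT.
by rewrite -memvE memv_pick.
Qed.

Section ThinHexagonSpan.
Variable F : finFieldType.
Implicit Types (a b : 'rV[F]_3) (i j k : 'I_3).

Lemma mem_Pi (M : 'M[F]_3) : (M \in Pi F) = (\tr M == 0).
Proof. by rewrite memv_ker lfunE. Qed.

Lemma outerE a b : a^T *m b = \matrix_(i, j) (a 0 i * b 0 j).
Proof. by apply/matrixP=> i j; rewrite !mxE big_ord1 !mxE. Qed.

Lemma trace_outer a b : a *m b^T = 0 -> \tr (a^T *m b) = 0.
Proof. by move=> ab; rewrite -mxtrace_tr trmx_mul trmxK mxtrace_mulC ab mxtrace0. Qed.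

Lemma outer_neq0 a b : a^T *m b != 0 -> a != 0 /\ b != 0.
Proof.
by move=> ab; split; apply: contraNneq ab => ->; rewrite ?trmx0 ?mul0mx ?mulmx0.
Qed.

Lemma Gamma_point_outer a b :
  a^T *m b != 0 -> a *m b^T = 0 -> Gamma_point <[a^T *m b]>.
Proof.
move=> /outer_neq0[a0 b0] ab; split; first by exists a, b; rewrite -outerE.
by rewrite -memvE mem_Pi trace_outer.
Qed.

Lemma outer_eq0 a b : a != 0 -> (a^T *m b == 0) = (b == 0).
Proof.
case/rV0Pn=> i ai; apply/eqP/eqP=> [/matrixP ab | ->]; last by rewrite mulmx0.
apply/rowP=> j; have /eqP := ab i j.
by rewrite outerE !mxE mulf_eq0 (negPf ai) => /eqP.
Qed.

(** All vectors of the span share the left factor [a], and their right factors stay orthogonal to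
    [a], so every point on it has rank one and trace zero. This is one of the two families of lines
    of Gamma. *)
Lemma Gamma_line_row a b b' :
    a *m b^T = 0 -> a *m b'^T = 0 ->
    a^T *m b != 0 -> a^T *m b' \notin <[a^T *m b]>%VS ->
  Gamma_line (<[a^T *m b']> + <[a^T *m b]>).
Proof.
move=> ab ab' n0 nin; split; first exact: dim_span2.
move=> P /dim1_vline[v v0 ->]; rewrite -memvE.
case/memv_addP=> _ /vlineP[s ->] [_ /vlineP[t ->] vE].
have {}vE : v = a^T *m (s *: b' + t *: b) by rewrite mulmxDr -!scalemxAr.
rewrite vE; apply: Gamma_point_outer; first by rewrite -vE.
by rewrite linearD !linearZ /= mulmxDr -!scalemxAr ab ab' !scaler0 addr0.
Qed.

(** The second family: the right factor [b] is fixed and the left factor varies inside the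
    orthogonal complement of [b]. *)
Lemma Gamma_line_col a a' b :
    a *m b^T = 0 -> a' *m b^T = 0 ->
    a^T *m b != 0 -> a'^T *m b \notin <[a^T *m b]>%VS ->
  Gamma_line (<[a'^T *m b]> + <[a^T *m b]>).
Proof.
move=> ab ab' n0 nin; split; first exact: dim_span2.
move=> P /dim1_vline[v v0 ->]; rewrite -memvE.
case/memv_addP=> _ /vlineP[s ->] [_ /vlineP[t ->] vE].
have {}vE : v = (s *: a' + t *: a)^T *m b.
  by rewrite linearD !linearZ /= mulmxDl -!scalemxAl.
rewrite vE; apply: Gamma_point_outer; first by rewrite -vE.
by rewrite mulmxDl -!scalemxAl ab ab' !scaler0 addr0.
Qed.

Lemma mulmx_delta_tr a k : a 0 k = 0 -> a *m (delta_mx 0 k : 'rV[F]_3)^T = 0.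
Proof.
by move=> ak; rewrite trmx_delta -colE; apply/rowP=> i; rewrite ord1 !mxE.
Qed.

(** The common zero at [k] makes the unit vector [e] orthogonal to both [a] and [b]. Replacing
    either factor by [e] then gives a second point on each of the two lines through the point, so
    both lines are explicit. *)
Lemma calO_outer a b k :
    a 0 k = 0 -> b 0 k = 0 -> a != 0 -> b != 0 -> a *m b^T = 0 ->
  calO <[a^T *m b]>.
Proof.
move=> ak bk a0 b0 ab.
pose e : 'rV[F]_3 := delta_mx 0 k.
have n0 : a^T *m b != 0 by rewrite outer_eq0.
have ae : a *m e^T = 0 by apply: mulmx_delta_tr.
have eb : e *m b^T = 0.
  by apply: trmx_inj; rewrite trmx_mul trmxK trmx0 mulmx_delta_tr.
have [i ai] := rV0Pn _ a0; have [j bj] := rV0Pn _ b0.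
(* Compare entries at [(i, k)]: the left side has [a 0 i], while column [k] of both generators
   vanishes because [b 0 k = 0]. Excluding the whole column line, not just [<[a^T *m b]>], also
   shows below that the two lines differ. *)
have rowN : a^T *m e \notin (<[e^T *m b]> + <[a^T *m b]>)%VS.
  apply/negP=> /memv_addP[_ /vlineP[s ->] [_ /vlineP[t ->] /matrixP/(_ i k)/eqP]].
  by rewrite !outerE !mxE bk !eqxx mulr1 !mulr0 addr0 (negPf ai).
(* Row [k] of [a^T *m b] vanishes, whereas [e^T *m b] has the entry [b 0 j] there. *)
have colN : e^T *m b \notin <[a^T *m b]>%VS.
  apply/negP=> /vlineP[s /matrixP/(_ k j)/eqP].
  by rewrite !outerE !mxE ak !eqxx mul1r mul0r mulr0 (negPf bj).
split; first by rewrite /proj_point dim_vline n0.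
exists <[a^T *m b]>%VS,
  ((<[a^T *m e]> + <[a^T *m b]>) + (<[e^T *m b]> + <[a^T *m b]>))%VS.
split; first exact: Gamma_point_outer.
  exists (<[a^T *m e]> + <[a^T *m b]>)%VS, (<[e^T *m b]> + <[a^T *m b]>)%VS.
  split=> //.
  - split; last exact: addvSr.
    apply: Gamma_line_row => //; apply: contra rowN; apply: subvP; exact: addvSr.
  - by split; [apply: Gamma_line_col | apply: addvSr].
  - by move=> eqL; move: rowN; rewrite -eqL memvE addvSl.
exact: subv_trans (addvSr _ _) (addvSr _ _).
Qed.

Lemma ord3_third i j : exists2 k, k != i & k != j.
Proof.
have : (0 < #|~: [set i; j]|)%N.
  by rewrite cardsCs setCK card_ord cards2; case: (i != j).
by case/card_gt0P=> k; rewrite !inE negb_or => /andP[ki kj]; exists k.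
Qed.

Lemma calO_delta i j : i != j -> calO <[delta_mx i j : 'M[F]_3]>.
Proof.
move=> ij; have [k ki kj] := ord3_third i j.
pose e l : 'rV[F]_3 := delta_mx 0 l.
have e0 l : e l != 0 by apply/rV0Pn; exists l; rewrite mxE !eqxx oner_eq0.
have -> : delta_mx i j = (e i)^T *m e j by rewrite trmx_delta mul_delta_mx.
apply: (@calO_outer _ _ k) => //; first by rewrite mxE (negPf ki) andbF.
  by rewrite mxE (negPf kj) andbF.
by apply: mulmx_delta_tr; rewrite mxE (eq_sym j) (negPf ij) andbF.
Qed.

Lemma calO_delta_diff i j : i != j ->
  calO <[delta_mx i i - delta_mx i j + (delta_mx j i - delta_mx j j) : 'M[F]_3]>.
Proof.
move=> ij; have [k ki kj] := ord3_third i j.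
pose e l : 'rV[F]_3 := delta_mx 0 l.
have eE l m : e l 0 m = (m == l)%:R by rewrite mxE eqxx.
have -> : delta_mx i i - delta_mx i j + (delta_mx j i - delta_mx j j)
    = (e i + e j)^T *m (e i - e j).
  by rewrite [(e i + e j)^T]linearD /= mulmxDl !mulmxBr !trmx_delta !mul_delta_mx.
apply: (@calO_outer _ _ k).
- by rewrite mxE !eE (negPf ki) (negPf kj) addr0.
- by rewrite !mxE /= (negPf ki) (negPf kj) subr0.
- by apply/rV0Pn; exists i; rewrite mxE !eE eqxx (negPf ij) addr0 oner_eq0.
- by apply/rV0Pn; exists i; rewrite !mxE /= eqxx (negPf ij) subr0 oner_eq0.
(* The scalar product of [e i + e j] and [e i - e j] is 1 - 1, which is zero in every
   characteristic, 2 included. *)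
rewrite linearB /= mulmxDl !mulmxBr !trmx_delta !mul_delta_mx_cond.
by rewrite !eqxx (eq_sym j) (negPf ij) !mulr0n !mulr1n subr0 sub0r subrr.
Qed.

Lemma Pi_sub_of_calO (H : {vspace 'M[F]_3}) :
  (forall P, calO P -> (P <= H)%VS) -> (Pi F <= H)%VS.
Proof.
move=> OH; apply/subvP=> M; rewrite mem_Pi => /eqP trM.
have offH i j : i != j -> delta_mx i j \in H.
  by move=> /calO_delta/OH; rewrite -memvE.
have diagH i j : delta_mx i i - delta_mx j j \in H.
  have [-> | ij] := eqVneq i j; first by rewrite subrr mem0v.
  (* The off-diagonal entries of the rank-one matrix are cancelled by matrix units already known to
     lie in [H]. *)
  have -> : delta_mx i i - delta_mx j j =
      (delta_mx i i - delta_mx i j + (delta_mx j i - delta_mx j j))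
      + (delta_mx i j - delta_mx j i) :> 'M[F]_3.
    by rewrite addrACA subrK [in RHS]addrAC subrr sub0r.
  apply: rpredD; last by rewrite rpredB ?offH // eq_sym.
  by have := OH _ (calO_delta_diff ij); rewrite -memvE.
(* As [\tr M = 0], subtracting [\tr M *: delta_mx ord0 ord0] changes nothing. Spread over the
   diagonal terms, it turns each [delta_mx i i] into a difference covered by [diagH]. *)
have -> : M = \sum_i \sum_j
    M i j *: (delta_mx i j - (i == j)%:R *: delta_mx ord0 ord0).
  rewrite [LHS](_ : M = M - \tr M *: delta_mx ord0 ord0); last first.
    by rewrite trM scale0r subr0.
  rewrite {1}(matrix_sum_delta M) scaler_suml -sumrB; apply: eq_bigr => i _.
  under [RHS]eq_bigr do rewrite scalerBr.
  rewrite sumrB [X in _ = _ - X](bigD1 i) //= eqxx scale1r.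
  rewrite [X in _ = _ - (_ + X)]big1 ?addr0 // => j ji.
  by rewrite eq_sym (negPf ji) scale0r scaler0.
apply: memv_suml => i _; apply: memv_suml => j _; apply: memvZ.
have [<- | ij] := eqVneq i j; first by rewrite scale1r.
by rewrite scale0r subr0 offH.
Qed.

End ThinHexagonSpan.

Theorem mainTheorem2 (q : nat) (F : finFieldType) (hF : #|F| = q)
    (hq : q = 1 %[mod 3]) :
  ~ exists H : {vspace 'M[F]_3},
      hyperplane_of (Pi F) H /\
      (forall P : {vspace 'M[F]_3}, calO P -> (P <= H)%VS).
Proof.
(* [Pi F <= H] would force [(\dim H).+1 <= \dim H]. *)
by case=> H [[_ dimPi] /Pi_sub_of_calO/dimvS]; rewrite dimPi ltnn.
Qed.
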